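(* Assume that for all $t\in\{0,\dots,T\}$ every finite collection $\{X^\theta\}_{\theta\in\Theta}\subseteq\mathscr L_t(\mathbb R^d)$ admits a supremum with respect to $\preceq^t$. Then for every time $t=0,1,\dots,T-1$ (and every state $S_t$) we have $$\mathcal V_t(S_t)\preccurlyeq^t\mathcal R_t(S_t,\mathcal V_{t+1}),\quad\text{i.e. }\ \mathcal R_t(S_t,\mathcal V_{t+1})\subseteq\mathcal V_t(S_t)+\mathscr L_t(C),$$ as well as $$\mathcal V_t(S_t)\curlyeqprec^t\mathcal R_t(S_t,\mathcal V_{t+1}),\quad\text{i.e. }\ \mathcal V_t(S_t)\subseteq\mathcal R_t(S_t,\mathcal V_{t+1})-\mathscr L_t(C).$$
   Context: Probabilistic setting. $(\Omega,\mathscr F)$ is a measurable space, $T\in\mathbb N$, $(\mathscr F_t)_{t=0,\dots,T}$ is the observation filtration, $\Theta\subset\mathbb R^d$ is a non-empty finite set, and $\{\mathbb Q_\theta:\theta\in\Theta\}$ is a family of probability measures on $(\Omega,\mathscr F)$, absolutely continuous with respect to a reference probability measure $\mathbb P$. $\mathbb E^\theta_t$ is the conditional expectation under $\mathbb Q_\theta$ given $\mathscr F_t$. All equalities, inequalities and inclusions are in the $\mathbb P$-a.s. sense. $\mathscr L_t(\mathbb R^d):=L^1(\Omega,\mathscr F_t,\mathbb P;\mathbb R^d)$. Conditional expectations $\mathbb E^\theta_t[X]$, $X\in\mathscr L_s(\mathbb R^d)$, $s\ge t$, are understood to be well-defined elements of $\mathscr L_t(\mathbb R^d)$, determined up to $\mathbb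 P$-null sets. Order. $\preceq$ is a fixed vector preorder on $\mathbb R^d$ (reflexive, transitive, and $x\preceq y$ implies $x+z\preceq y+z$ and $\alpha x\preceq\alpha y$ for $z\in\mathbb R^d$, $\alpha\ge0$), with ordering cone $C=\{x\in\mathbb R^d:0\preceq x\}$ (a convex cone containing $0$). $\mathscr L_t(C)\subseteq\mathscr L_t(\mathbb R^d)$ is the set of elements with values in $C$; for $X,Y\in\mathscr L_t(\mathbb R^d)$, $X\preceq^tY$ iff $Y-X\in\mathscr L_t(C)$. For sets $A,B\subseteq\mathscr L_t(\mathbb R^d)$: $A\preccurlyeq^tB$ iff $B\subseteq A+\mathscr L_t(C)$; $A\curlyeqprec^tB$ iff $A\subseteq B-\mathscr L_t(C)$ (Minkowski sums). Supremum. A supremum of $\{X^\theta\}_{\theta\in\Theta}\subseteq\mathscr L_t(\mathbb R^d)$ with respect to $\preceq^t$ is a $V\in\mathscr L_t(\mathbb R^d)$ such that (i) $X^\theta\preceq^tV$ for all $\theta\in\Theta$, and (ii) if $A\in\mathscr L_t(\mathbb R^d)$ satisfies $X^\theta\preceq^tA$ for all $\theta$, then $V\preceq^tA$. It need not be unique; $\operatorname{v-sup}^t_{\theta\in\Theta}X^\theta$ denotes one arbitrarily chosen supremum (the result holds for any choice). Control setting. $S_{t+1}=F(t,S_t,\varphi_t,Z_{t+1})$, $t=0,\dots,T-1$, $S_0=s$, where $S$ takes values in a measurable space $\mathbb S\subset\mathbb R^m$, $Z$ is an $\mathbb R^k$-valued random sequence, the controls $\varphi_t$ take values in a compact set $A$,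 and $F$ is measurable. Given the state $S_t$ at time $t$, $\mathfrak A_t(S_t)$ is the set of admissible one-step controls $\varphi_t$ and $\mathfrak A^t(S_t)$ is the set of admissible controls $\varphi=(\varphi_t,\dots,\varphi_{T-1})$ starting at time $t$; one has $(\varphi_t,\tilde\varphi)\in\mathfrak A^t(S_t)$ iff $\varphi_t\in\mathfrak A_t(S_t)$ and $\tilde\varphi\in\mathfrak A^{t+1}(F(t,S_t,\varphi_t,Z_{t+1}))$. $S^\varphi_T$ is the terminal state generated from $S_t$ by $\varphi$, and states $S_t$ are $\mathscr F_t$-measurable. $\ell:\mathbb S\to\mathbb R^d$ is a loss function, with $\ell(S^\varphi_T)\in\mathscr L_T(\mathbb R^d)$ for admissible $\varphi$. Value functions. $\mathcal V_T(S_T)=\{\ell(S_T)\}$ and, for $t=0,\dots,T-1$, $$\mathcal V_t(S_t)=\Big\{\operatorname{v-sup}^t_{\theta\in\Theta}\mathbb E^\theta_t[\ell(S^\varphi_T)]:\varphi\in\mathfrak A^t(S_t)\Big\},$$ $$\mathcal R_t(S_t,\mathcal V_{t+1})=\Big\{\operatorname{v-sup}^t_{\theta\in\Theta}\mathbb E^\theta_t[X]:\varphi_t\in\mathfrak A_t(S_t),\ X\in\mathcal V_{t+1}(F(t,S_t,\varphi_t,Z_{t+1}))\Big\}.$$ *)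

(* Defs.v *)
From HB Require Import structures.
From mathcomp Require Import all_boot all_order all_algebra.
From mathcomp Require Import all_classical all_reals all_analysis.
Import Order.TTheory GRing.Theory Num.Theory.
Import numFieldNormedType.Exports.

Set Implicit Arguments.
Unset Strict Implicit.
Unset Printing Implicit Defensive.

Local Open Scope classical_set_scope.
Local Open Scope ring_scope.

Record is_vector_preorder (R : realType) (d : nat)
    (le : 'rV[R]_d -> 'rV[R]_d -> Prop) : Prop := {
  vpre_refl : forall x, le x x;
  vpre_trans : forall x y z, le x y -> le y z -> le x z;
  vpre_add : forall x y z, le x y -> le (x + z) (y + z);
  vpre_scale : forall x y (a : R), 0 <= a -> le x y -> le (a *: x) (a *: y) }.

Definition ordering_cone (R : realType) (d : nat)
    (le : 'rV[R]_d -> 'rV[R]_d -> Prop) : set 'rV[R]_d := [set x | le 0 x].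

Section Stochastic.
Context (disp : measure_display) (Omega : measurableType disp) (R : realType).

(* Only the sigma-algebras with index at most T matter. *)
Record is_filtration (T : nat) (Fil : nat -> set (set Omega)) : Prop := {
  filtration_sigma : forall t, (t <= T)%N -> sigma_algebra setT (Fil t);
  filtration_sub : forall t, (t <= T)%N -> Fil t `<=` measurable;
  filtration_mono : forall s t, (s <= t)%N -> (t <= T)%N -> Fil s `<=` Fil t }.

(* Measurability with respect to a sub-sigma-algebra G, coordinate by
   coordinate. *)
Definition vmeasurable (G : set (set Omega)) (n : nat)
    (X : Omega -> 'rV[R]_n) : Prop :=
  forall (i : 'I_n) (B : set R), measurable B ->
    G ((fun w => X w 0 i) @^-1` B).

Definition vintegrable (mu : {measure set Omega -> \bar R}) (n : nat)
    (X : Omega -> 'rV[R]_n) : Prop :=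
  forall i : 'I_n, mu.-integrable setT (fun w => (X w 0 i)%:E).

(* Representatives of the elements of L^1(Omega, G, P; R^d). *)
Definition L1 (P : probability Omega R) (G : set (set Omega)) (d : nat) :
    set (Omega -> 'rV[R]_d) :=
  [set X | vmeasurable G X /\ vintegrable P X].

Definition L1in (P : probability Omega R) (G : set (set Omega)) (d : nat)
    (C : set 'rV[R]_d) : set (Omega -> 'rV[R]_d) :=
  [set X | L1 P G X /\ {ae P, forall w, C (X w)}].

Definition vle (P : probability Omega R) (G : set (set Omega)) (d : nat)
    (C : set 'rV[R]_d) (X Y : Omega -> 'rV[R]_d) : Prop :=
  L1in P G C (Y \- X).

(* The two set orders. Since members of the sets involved are G-measurable
   representatives and L1in is closed under P-a.s. modification among
   these, pointwise Minkowski sums and P-a.s. ones give the same relations. *)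
Definition set_le_lower (P : probability Omega R) (G : set (set Omega))
    (d : nat) (C : set 'rV[R]_d) (A B : set (Omega -> 'rV[R]_d)) : Prop :=
  B `<=` [set a \+ c | a in A & c in L1in P G C].

Definition set_le_upper (P : probability Omega R) (G : set (set Omega))
    (d : nat) (C : set 'rV[R]_d) (A B : set (Omega -> 'rV[R]_d)) : Prop :=
  A `<=` [set b \- c | b in B & c in L1in P G C].

Definition is_vsup (P : probability Omega R) (G : set (set Omega)) (d : nat)
    (C : set 'rV[R]_d) (I : Type) (Theta : set I)
    (X : I -> Omega -> 'rV[R]_d) (V : Omega -> 'rV[R]_d) : Prop :=
  [/\ L1 P G V,
      forall theta, Theta theta -> vle P G C (X theta) V &
      forall A, L1 P G A ->
        (forall theta, Theta theta -> vle P G C (X theta) A) -> vle P G C V A].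

Definition is_condexp (Q : probability Omega R) (G : set (set Omega))
    (d : nat) (X Y : Omega -> 'rV[R]_d) : Prop :=
  [/\ vintegrable Q X, L1 Q G Y &
      forall B, G B -> forall i : 'I_d,
        (\int[Q]_(w in B) (Y w 0 i)%:E = \int[Q]_(w in B) (X w 0 i)%:E)%E].

(* One version; the value is junk when there is none. *)
Definition condexp (Q : probability Omega R) (G : set (set Omega)) (d : nat)
    (X : Omega -> 'rV[R]_d) : Omega -> 'rV[R]_d :=
  xget (cst 0) [set Y | is_condexp Q G X Y].

(* The conditional expectation under Q is a well-defined element of
   L^1(Omega, G, P; R^d), determined up to P-null (not merely Q-null) sets. *)
Definition condexp_well_defined (P Q : probability Omega R)
    (G : set (set Omega)) (d : nat) (X : Omega -> 'rV[R]_d) : Prop :=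
  [/\ exists Y, is_condexp Q G X Y,
      forall Y, is_condexp Q G X Y -> L1 P G Y &
      forall Y Y', is_condexp Q G X Y -> is_condexp Q G X Y' ->
        {ae P, forall w, Y w = Y' w}].

End Stochastic.

(* Measurability of f on D for the trace on D of the ambient sigma-algebra;
   measurable_fun D f would be vacuous for a non-measurable D. *)
Definition trace_measurable_fun (d1 d2 : measure_display)
    (X : measurableType d1) (Y : measurableType d2) (f : X -> Y) (D : set X) :
    Prop :=
  forall B : set Y, measurable B ->
    exists2 E : set X, measurable E & D `&` f @^-1` B = D `&` E.

Notation borelType X := (g_sigma_algebraType (@open X)).

Section Control.
Context (disp : measure_display) (Omega : measurableType disp) (R : realType).
Context (m k : nat) (U : ptopologicalType).

Definition next_state (F : nat -> 'rV[R]_m -> U -> 'rV[R]_k -> 'rV[R]_m)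
    (Z : nat -> Omega -> 'rV[R]_k) (t : nat) (S : Omega -> 'rV[R]_m)
    (phi : Omega -> U) : Omega -> 'rV[R]_m :=
  fun w => F t (S w) (phi w) (Z t.+1 w).

Fixpoint terminal_state (F : nat -> 'rV[R]_m -> U -> 'rV[R]_k -> 'rV[R]_m)
    (Z : nat -> Omega -> 'rV[R]_k) (t : nat) (S : Omega -> 'rV[R]_m)
    (phis : seq (Omega -> U)) : Omega -> 'rV[R]_m :=
  if phis is phi :: phis' then
    terminal_state F Z t.+1 (next_state F Z t S phi) phis'
  else S.

(* adm t S is the set of admissible one-step controls at time t in state S.
   A control starting at time t is the list (phi_t, ..., phi_{T-1}); at
   time T the empty list is the only one. *)
Fixpoint admissible (T : nat)
    (F : nat -> 'rV[R]_m -> U -> 'rV[R]_k -> 'rV[R]_m)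
    (Z : nat -> Omega -> 'rV[R]_k)
    (adm : nat -> (Omega -> 'rV[R]_m) -> set (Omega -> U))
    (t : nat) (S : Omega -> 'rV[R]_m) (phis : seq (Omega -> U)) : Prop :=
  if phis is phi :: phis' then
    [/\ (t < T)%N, adm t S phi &
        admissible T F Z adm t.+1 (next_state F Z t S phi) phis']
  else t = T.

(* states t is the collection of states S_t under consideration: any family
   that contains the initial state and is stable under the dynamics, such as
   the states reachable from s, or all Fil t-measurable SS-valued ones when
   these are stable. *)
Record is_control_system (T : nat) (Fil : nat -> set (set Omega))
    (SS : set 'rV[R]_m) (A : set U)
    (F : nat -> 'rV[R]_m -> U -> 'rV[R]_k -> 'rV[R]_m)
    (Z : nat -> Omega -> 'rV[R]_k) (s : 'rV[R]_m)
    (adm : nat -> (Omega -> 'rV[R]_m) -> set (Omega -> U))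
    (states : nat -> set (Omega -> 'rV[R]_m)) : Prop := {
  cs_compact : compact A;
  cs_noise : forall t, (t < T)%N -> vmeasurable measurable (Z t.+1);
  cs_dynamics : forall t x a z, (t < T)%N -> SS x -> A a -> SS (F t x a z);
  cs_dynamics_measurable : forall t, (t < T)%N ->
    trace_measurable_fun
      (fun p : borelType 'rV[R]_m * borelType U * borelType 'rV[R]_k =>
         F t p.1.1 p.1.2 p.2 : borelType 'rV[R]_m)
      (SS `*` A `*` setT);
  cs_control : forall t S phi, (t < T)%N -> states t S -> adm t S phi ->
    forall w, A (phi w);
  cs_state : forall t S, (t <= T)%N -> states t S ->
    vmeasurable (Fil t) S /\ forall w, SS (S w);
  cs_initial : states 0%N (cst s);
  cs_next : forall t S phi, (t < T)%N -> states t S -> adm t S phi ->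
    states t.+1 (next_state F Z t S phi) }.

Context (d : nat) (I : Type).

(* vsup t X is the chosen supremum at time t of the family X, and
   E theta t X the conditional expectation of X under Q_theta at time t. *)
Definition value_set (T : nat)
    (F : nat -> 'rV[R]_m -> U -> 'rV[R]_k -> 'rV[R]_m)
    (Z : nat -> Omega -> 'rV[R]_k)
    (adm : nat -> (Omega -> 'rV[R]_m) -> set (Omega -> U))
    (ell : 'rV[R]_m -> 'rV[R]_d)
    (E : I -> nat -> (Omega -> 'rV[R]_d) -> Omega -> 'rV[R]_d)
    (vsup : nat -> (I -> Omega -> 'rV[R]_d) -> Omega -> 'rV[R]_d)
    (t : nat) (S : Omega -> 'rV[R]_m) : set (Omega -> 'rV[R]_d) :=
  if t == T then [set ell \o S]
  else [set vsup t (fun theta => E theta t (ell \o terminal_state F Z t S phis))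
         | phis in admissible T F Z adm t S].

Definition recursion_set
    (F : nat -> 'rV[R]_m -> U -> 'rV[R]_k -> 'rV[R]_m)
    (Z : nat -> Omega -> 'rV[R]_k)
    (adm : nat -> (Omega -> 'rV[R]_m) -> set (Omega -> U))
    (E : I -> nat -> (Omega -> 'rV[R]_d) -> Omega -> 'rV[R]_d)
    (vsup : nat -> (I -> Omega -> 'rV[R]_d) -> Omega -> 'rV[R]_d)
    (t : nat) (S : Omega -> 'rV[R]_m)
    (V : (Omega -> 'rV[R]_m) -> set (Omega -> 'rV[R]_d)) :
    set (Omega -> 'rV[R]_d) :=
  [set Y | exists phi X, [/\ adm t S phi, V (next_state F Z t S phi) X &
     Y = vsup t (fun theta => E theta t X)]].

End Control.

(* Main.v *)
Require Import Defs.
From HB Require Import structures.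
From mathcomp Require Import all_boot all_order all_algebra.
From mathcomp Require Import all_classical all_reals all_analysis.
From mathcomp Require Import ring lra zify measurable_realfun.
Import Order.TTheory GRing.Theory Num.Theory.
Import numFieldNormedType.Exports.

(** Fix t and a control phi :: phis, let L be its terminal loss and let X be the
    element of the value set at time t+1 that phis produces.  Both inclusions
    say that v-sup of E_t[L] is below v-sup of E_t[X], and this follows from
    E_t[L] <= E_t[X] for each model: by the tower property,
    E_t[X] - E_t[L] = E_t[X - E_(t+1)[L]], and X - E_(t+1)[L] has values in the
    cone C because X is an upper bound of the family E_(t+1)[L] (at
    t+1 = T, where X is L itself, nothing is to be proved).

    The substance of the proof is the step from W in C a.s. to E_t[W] in C
    a.s.  For an arbitrary convex cone it is wrong: C need be neither closed
    nor Borel, and for a non-measurable C the conditional expectation may leave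
    C.  It is the existence of suprema that makes C tame, as follows.

    - [lexcone] is the class of the cones obtained from the whole space by
      finite intersections and by lexicographic refinement of open half-spaces.
      Such cones are Borel, and for them the step is proved by induction on the
      construction ([condexp_lexcone]).  Conversely every total cone, i.e. the
      cone of a linear preorder of the space, is of this kind
      ([total_lexcone]).

    - A point outside a convex cone is outside some total cone containing it
      ([total_extension]), so the mean of an integrable vector with values in
      any convex cone stays in the cone ([mean_cone]).

    - If there are at least two models, the supremum of two constants exists in
      L^1, perhaps as a random vector; its mean is then a supremum of the two
      constants in the space itself, so C is the cone of a vector lattice up to
      its lineality space ([vsup_lattice]).  In finite dimension such a cone is
      a finite intersection of total cones: disjoint a, b > 0 split C as the
      intersection of C + Ra and C + Rb, which are again lattice cones, with
      larger lineality spaces ([lattice_lexcone]).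

    - If there is only one model, X is equivalent to E_(t+1)[L], so the
      difference has values in the lineality space of C, a linear subspace and
      hence a [lexcone].

    [vsup_slack_lexcone] unites the two cases. *)

Set Implicit Arguments.
Unset Strict Implicit.
Unset Printing Implicit Defensive.

Local Open Scope classical_set_scope.
Local Open Scope ring_scope.

(** * Convex cones in finite dimension *)

Section Cones.
Context (R : realType) (d : nat).
Implicit Types (C M : set 'rV[R]_d) (x y a u v : 'rV[R]_d) (c : 'cV[R]_d).

Definition convex_cone C : Prop :=
  [/\ C 0, forall x y, C x -> C y -> C (x + y) &
      forall r x, 0 <= r -> C x -> C (r *: x)].

Definition total_cone C : Prop := forall x, C x \/ C (- x).

Definition lattice_cone C : Prop := forall x, exists v,
  [/\ C v, C (v - x) & forall u, C u -> C (u - x) -> C (u - v)].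

(** The lineality space, on which the preorder of C identifies all points. *)
Definition lineality C : set 'rV[R]_d := [set x | C x /\ C (- x)].

Definition lform c x : R := (x *m c) 0 0.

(** Half-spaces refined lexicographically: [lexcone_lex] compares by the linear
    form c first and, in case of a tie, by C.  Neither closed nor open in
    general, but always Borel. *)
Inductive lexcone : set 'rV[R]_d -> Prop :=
| lexconeT : lexcone setT
| lexconeI C1 C2 : lexcone C1 -> lexcone C2 -> lexcone (C1 `&` C2)
| lexcone_lex c C : lexcone C ->
    lexcone [set x | 0 < lform c x \/ lform c x = 0 /\ C x].

Lemma lformE c x : lform c x = \sum_i x 0 i * c i 0.
Proof. by rewrite /lform mxE. Qed.

Lemma lformD c x y : lform c (x + y) = lform c x + lform c y.
Proof. by rewrite /lform mulmxDl mxE. Qed.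

Lemma lformZ c r x : lform c (r *: x) = r * lform c x.
Proof. by rewrite /lform -scalemxAl mxE. Qed.

Lemma lformN c x : lform c (- x) = - lform c x.
Proof. by rewrite /lform mulNmx mxE. Qed.

Lemma lformNl c x : lform (- c) x = - lform c x.
Proof. by rewrite /lform mulmxN mxE. Qed.

Lemma lexcone0 C : lexcone C -> C 0.
Proof.
elim=> [//|C1 C2 _ C10 _ C20|c C' _ C'0] //.
by right; split=> //; rewrite /lform mul0mx mxE.
Qed.

Lemma cone_sum C (I : finType) (F : I -> 'rV[R]_d) :
  convex_cone C -> (forall i, C (F i)) -> C (\sum_i F i).
Proof. by move=> [C0 CD _] CF; elim/big_ind: _ => // *; exact: CD. Qed.

Lemma lineality_lin C r x y : convex_cone C ->
  lineality C x -> lineality C y -> lineality C (r *: x + y).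
Proof.
move=> [C0 CD CZ] [Cx CNx] [Cy CNy].
have [r0|r0] := leP 0 r; split.
- by apply: CD => //; exact: CZ.
- by rewrite opprD -scalerN; apply: CD => //; exact: CZ.
- apply: CD => //; rewrite -[_ *: _]opprK -scaleNr -scalerN.
  by apply: CZ => //; lra.
- by rewrite opprD; apply: CD => //; rewrite -scaleNr; apply: CZ => //; lra.
Qed.

(** A matrix of maximal rank among those with row space inside the lineality
    space must span it; this gives the lineality space a dimension. *)
Lemma lineality_mx C : convex_cone C ->
  exists A : 'M[R]_d, forall x, lineality C x <-> (x <= A)%MS.
Proof.
move=> Ccone; have [C0 CD CZ] := Ccone.
have L0 : lineality C 0 by split; rewrite ?oppr0.
pose p n := `[< exists2 A : 'M[R]_d, \rank A = n &
                forall x, (x <= A)%MS -> lineality C x >].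
have p0 : exists n, p n.
  exists 0%N; apply/asboolP; exists 0; rewrite ?mxrank0// => x.
  by rewrite submx0 => /eqP->.
have pd n : p n -> (n <= d)%N by move/asboolP=> [A <- _]; exact: rank_leq_row.
have [n /asboolP[A An AL] nmax] := ex_maxnP p0 pd.
exists A => x; split=> [Lx|]; last exact: AL.
apply: contrapT => xA.
have : (\rank (A + x)%MS <= n)%N.
  apply: nmax; apply/asboolP; exists (A + x)%MS => // y.
  move=> /sub_addsmxP[[s t] /= ->].
  rewrite addrC [t]mx11_scalar mul_scalar_mx; apply: lineality_lin => //.
  by apply: AL; exact: submxMl.
rewrite -An leqNgt (ltn_leqif (mxrank_leqif_sup (addsmxSl A x))) negbK.
by move/(submx_trans (addsmxSr A x)).
Qed.

(** Induction on the codimension of the lineality space, within a class N of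
    cones. *)
Lemma lineality_ind (N Good : set 'rV[R]_d -> Prop) :
  (forall C, convex_cone C -> N C ->
     (forall C' a, convex_cone C' -> N C' -> lineality C `<=` lineality C' ->
        lineality C' a -> ~ lineality C a -> Good C') -> Good C) ->
  forall C, convex_cone C -> N C -> Good C.
Proof.
move=> step C Ccone NC.
have [A AP] := lineality_mx Ccone.
have [n] := ubnP (d - \rank A); elim: n => // n IH in C A Ccone NC AP *.
rewrite ltnS => An; apply: step => // C' a C'cone NC' CC' C'a Ca.
have [A' A'P] := lineality_mx C'cone.
apply: (IH _ _ _ _ A'P) => //.
have AA' : (A <= A')%MS.
  by apply/row_subP => i; apply/A'P/CC'/AP; exact: row_sub.
have : (\rank A < \rank A')%N.
  rewrite (ltn_leqif (mxrank_leqif_sup AA')); apply/negP => A'A.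
  by apply/Ca/AP/(submx_trans _ A'A)/A'P.
by have := rank_leq_row A'; lia.
Qed.

(** The cone generated by C and -a, hence C + Ra when a is in C. *)
Definition adjoin C a : set 'rV[R]_d :=
  [set x | exists2 r, 0 <= r & C (x + r *: a)].

Lemma adjoin_cone C a : convex_cone C -> convex_cone (adjoin C a).
Proof.
move=> [C0 CD CZ]; split.
- by exists 0; rewrite // scale0r addr0.
- move=> x y [r r0 Cx] [s s0 Cy]; exists (r + s); first exact: addr_ge0.
  by rewrite scalerDl addrACA; exact: CD.
- move=> s x s0 [r r0 Cx]; exists (s * r); first exact: mulr_ge0.
  by rewrite -scalerA -scalerDr; exact: CZ.
Qed.

Lemma sub_adjoin C a : C `<=` adjoin C a.
Proof. by move=> x Cx; exists 0; rewrite // scale0r addr0. Qed.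

Lemma adjoin_opp C a : convex_cone C -> adjoin C a (- a).
Proof. by move=> [C0 _ _]; exists 1; rewrite // scale1r addNr. Qed.

(** Separation without topology: a convex cone that contains C and is maximal
    among those avoiding y is total.  For if neither x nor -x belongs to it,
    adjoining either one captures y, and y is a positive combination of the two
    resulting expressions in which x cancels. *)
Lemma total_extension C y : convex_cone C -> ~ C y ->
  exists M, [/\ convex_cone M, total_cone M, C `<=` M & ~ M y].
Proof.
move=> Ccone nCy.
(* the empty set is allowed because it is the union of the empty chain *)
pose p X := X = set0 \/ [/\ convex_cone X, C `<=` X & ~ X y].
have [F Fp Ftot|A [pA Amax]] := @Zorn_bigcup _ p.
  have [Fne|F0] := pselect (exists2 X, F X & X !=set0); last first.
    left; apply/seteqP; split=> // x [X FX Xx].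
    by apply: F0; exists X => //; exists x.
  have FP X x : F X -> X x -> [/\ convex_cone X, C `<=` X & ~ X y].
    by move=> FX Xx; case: (Fp _ FX) => // X0; move: Xx; rewrite X0.
  have [X0 FX0 [x0 X0x0]] := Fne; have [[X00 _ _] CX0 _] := FP _ _ FX0 X0x0.
  right; split; first split.
  - by exists X0.
  - move=> x z [X FX Xx] [Y FY Yz].
    have [[_ XD _] _ _] := FP _ _ FX Xx; have [[_ YD _] _ _] := FP _ _ FY Yz.
    case: (Ftot _ _ FX FY) => XY.
      by exists Y => //; apply: YD => //; exact: XY.
    by exists X => //; apply: XD => //; exact: XY.
  - move=> r x r0 [X FX Xx]; have [[_ _ XZ] _ _] := FP _ _ FX Xx.
    by exists X => //; exact: XZ.
  - by move=> x Cx; exists X0 => //; exact: CX0.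
  - by move=> [X FX Xy]; have [_ _ /(_ Xy)] := FP _ _ FX Xy.
have [A0|[Acone CA nAy]] := pA.
  exfalso; apply: (Amax C); last by right; split.
  rewrite A0; split=> // /(_ 0); apply.
  by case: Ccone.
exists A; split=> // x.
have key z : ~ A z -> adjoin A (- z) y.
  move=> nAz; apply: contrapT => nay; apply: (Amax (adjoin A (- z))).
    split; first exact: sub_adjoin.
    by move=> /(_ z) h; apply/nAz/h; rewrite -{2}[z]opprK; exact: adjoin_opp.
  right; split=> //; first exact: adjoin_cone.
  by apply: subset_trans CA _; exact: sub_adjoin.
have [Ax|nAx] := pselect (A x); first by left.
right; apply: contrapT => nANx.
have [r r0 Ar] := key _ nAx; have [s s0 As] := key _ nANx.
have [_ AD AZ] := Acone.
have := AD _ _ (AZ s _ s0 Ar) (AZ r _ r0 As).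
rewrite opprK scalerN !scalerDr !scalerN !scalerA (mulrC r s).
rewrite addrACA addNr addr0 -scalerDl => Ay.
have [rs|rs] := eqVneq (s + r) 0.
  have r00 : r = 0 by lra.
  by apply: nAy; move: Ar; rewrite r00 scale0r addr0.
apply: nAy; rewrite -[y]scale1r -(mulVf rs) -scalerA; apply: AZ => //.
by rewrite invr_ge0 addr_ge0.
Qed.

(** A total cone other than the whole space lies between an open half-space and
    its closure.  For the order of M, the sum u of the basis vectors with signs
    chosen in M is an order unit, and x differs from phi(x) u, where phi(x) is
    the supremum of the r with r u <= x, by arbitrarily small multiples of u;
    this makes phi the linear form sought. *)
Lemma total_form M y : convex_cone M -> total_cone M -> ~ M y ->
  exists c, [/\ forall x, 0 < lform c x -> M x,
                forall x, M x -> 0 <= lform c x &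
                exists e, lform c e != 0].
Proof.
move=> Mcone Mtot nMy; have [M0 MD MZ] := Mcone.
pose e i : 'rV[R]_d := delta_mx 0 i.
have /boolp.choice[sg sgP] : forall i, exists s : R, `|s| = 1 /\ M (s *: e i).
  move=> i.
  have [Mi|Mi] := Mtot (e i); [exists 1|exists (-1)];
    by rewrite ?normrN normr1 ?scaleN1r ?scale1r.
pose u := \sum_i sg i *: e i.
pose nm x := \sum_i `|x 0 i|.
have nm0 x : 0 <= nm x by exact: sumr_ge0.
have ub x : M (nm x *: u - x).
  rewrite {2}[x]row_sum_delta scaler_sumr -sumrB; apply: cone_sum => // i.
  have [si Mi] := sgP i.
  have s2 : sg i * sg i = 1 by rewrite -expr2 -real_normK ?num_real// si expr1n.
  rewrite -/(e i).
  rewrite (_ : _ - _ = (nm x - x 0 i * sg i) *: (sg i *: e i)); last first.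
    by rewrite scalerBl !scalerA -mulrA s2 mulr1.
  apply: MZ => //; rewrite subr_ge0 (le_trans (ler_norm _))// normrM si mulr1.
  by rewrite /nm (bigD1 i)//= lerDl sumr_ge0.
have nMNu r : 0 < r -> ~ M (- (r *: u)).
  move=> r0 Mu; apply: nMy.
  have Mu' : M (- u).
    rewrite -[u]scale1r -(mulVf (lt0r_neq0 r0)) -scalerA -scalerN.
    by apply: MZ => //; rewrite invr_ge0 ltW.
  have := MD _ _ (MZ _ _ (nm0 (- y)) Mu') (ub (- y)).
  by rewrite scalerN opprK addrA addNr add0r.
pose cut x := [set r | M (x - r *: u)].
pose phi x := sup (cut x).
have cutP x : has_sup (cut x).
  split.
    exists (- nm (- x)); rewrite /cut/= scaleNr opprK addrC.
    by have := ub (- x); rewrite opprK.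
  exists (nm x) => r /= Mr; rewrite leNgt; apply/negP => lt.
  apply: (nMNu (r - nm x)); first by rewrite subr_gt0.
  rewrite scalerBl opprB -[nm x *: u](subrK x) -addrA; exact: MD.
have cutL x r : 0 < r -> M (x - (phi x - r) *: u).
  move=> r0; have [s /= Ms ls] := sup_adherent r0 (cutP x).
  have -> : x - (phi x - r) *: u = x - s *: u + (s - (phi x - r)) *: u.
    by rewrite [(s - _) *: u]scalerBl addrA subrK.
  apply: MD => //; apply: MZ; first by rewrite subr_ge0 ltW.
  by apply: cone_sum => // i; case: (sgP i).
have cutR x r : 0 < r -> M ((phi x + r) *: u - x).
  move=> r0; have [Mx|] := Mtot (x - (phi x + r) *: u); last by rewrite opprB.
  have := sup_upper_bound (cutP x) Mx; rewrite /= -/(phi x); lra.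
(* Only the values of phi at the basis vectors enter, so that the linearity of
   phi need not be proved: the errors of the approximations e_i ~ phi(e_i) u
   add up in [low]. *)
exists (\col_i phi (e i)); set f := lform _.
have fE x : f x = \sum_i x 0 i * phi (e i).
  by rewrite /f lformE; under eq_bigr do rewrite mxE.
have Mu : M u by apply: cone_sum => // i; case: (sgP i).
have low x r : 0 < r -> M (x - (f x - r) *: u).
  move=> r0; have nx1 : 0 < nm x + 1 by rewrite ltr_wpDl.
  pose s := r / (nm x + 1); have s0 : 0 < s by exact: divr_gt0.
  have rs : r = nm x * s + s by rewrite /s; field; exact: lt0r_neq0.
  have -> : x - (f x - r) *: u =
      \sum_i (x 0 i *: (e i - phi (e i) *: u) + (`|x 0 i| * s) *: u) + s *: u.
    rewrite big_split/= -scaler_suml -mulr_suml -/(nm x).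
    under eq_bigr do rewrite scalerBr scalerA.
    rewrite sumrB -scaler_suml -fE /e -row_sum_delta.
    by rewrite -!addrA -scalerDl -rs scalerBl opprB [_ + r *: u]addrC.
  apply: MD; last by apply: MZ => //; exact: ltW.
  apply: cone_sum => // i; have [x0|x0] := leP 0 (x 0 i).
    rewrite ger0_norm// -scalerA -scalerDr; apply: MZ => //.
    by have := cutL (e i) _ s0; rewrite scalerBl opprB addrA addrAC.
  rewrite ltr0_norm//.
  rewrite (_ : _ + _ = - x 0 i *: ((phi (e i) + s) *: u - e i)); last first.
    rewrite !scalerBr !scalerA scaleNr opprK mulrDr scalerDl [RHS]addrC addrA.
    by rewrite [- _ * phi _]mulNr scaleNr.
  by apply: MZ; [rewrite oppr_ge0 ltW|exact: cutR].
have pos x : 0 < f x -> exists2 r, 0 < r & M (x - r *: u).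
  move=> fx; exists (f x / 2); first exact: divr_gt0.
  by have := low x (f x / 2) ltac:(lra); rewrite (_ : f x - f x / 2 = f x / 2);
    last field.
split.
- move=> x /pos[r r0 Mr]; rewrite -[x](subrK (r *: u)); apply: MD => //.
  by apply: MZ => //; exact: ltW.
- move=> x Mx; rewrite leNgt; apply/negP => fx.
  have [|r r0 Mr] := pos (- x); first by rewrite /f lformN oppr_gt0.
  by apply: (nMNu r r0); have := MD _ _ Mx Mr; rewrite addrA subrr add0r.
- exists u; apply/negP => /eqP fu.
  have fNu : f (- u) = 0 by rewrite /f lformN -/f fu oppr0.
  have := low (- u) (1/2) ltac:(lra); rewrite fNu => h.
  apply: (nMNu (1/2)); first lra.
  rewrite (_ : - _ = - u - (0 - 1 / 2) *: u)//.
  rewrite -scaleN1r -scaleNr -[- u]scaleN1r scalerA -scalerDl.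
  by congr (_ *: _); lra.
Qed.

(** With the form c of [total_form], membership in M is decided by c off the
    kernel of c; on the kernel it is decided by M', the preimage of M under a
    projection to the kernel, which is total with one more dimension of
    lineality. *)
Lemma total_lexcone M : convex_cone M -> total_cone M -> lexcone M.
Proof.
move: M; apply: lineality_ind => M Mcone Mtot IH; have [M0 MD MZ] := Mcone.
have [MT|/existsNP[y nMy]] := pselect (forall y, M y).
  rewrite (_ : M = setT); first exact: lexconeT.
  by apply/seteqP; split.
have [c [cM Mc [e ce]]] := total_form Mcone Mtot nMy.
(* the projection onto the kernel of c, along e *)
pose proj x := x - (lform c x / lform c e) *: e.
have projD x z : proj (x + z) = proj x + proj z.
  by rewrite /proj lformD mulrDl scalerDl opprD addrACA.
have projZ r x : proj (r *: x) = r *: proj x.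
  by rewrite /proj lformZ -mulrA -scalerA -scalerBr.
have projN x : proj (- x) = - proj x by rewrite -scaleN1r projZ scaleN1r.
have proj_id x : lform c x = 0 -> proj x = x.
  by rewrite /proj => ->; rewrite mul0r scale0r subr0.
have proje : proj e = 0 by rewrite /proj divff// scale1r subrr.
pose M' := [set x | M (proj x)].
have -> : M = [set x | 0 < lform c x \/ lform c x = 0 /\ M' x].
  apply/seteqP; split=> [x Mx|x /= [/cM//|[cx]]]; last by rewrite /M'/= proj_id.
  have := Mc _ Mx; rewrite le_eqVlt => /orP[/eqP cx|]; last by left.
  by right; split=> //; rewrite /M'/= proj_id.
have Lc x : lineality M x -> lform c x = 0.
  by move=> [/Mc ? /Mc]; rewrite lformN => ?; lra.
apply: lexcone_lex; apply: (IH M' e).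
- split; rewrite /M'/=.
  + by rewrite -(scale0r e) projZ scale0r.
  + by move=> x z ? ?; rewrite projD; exact: MD.
  + by move=> r x ? ?; rewrite projZ; exact: MZ.
- by move=> x; rewrite /M'/= projN.
- by move=> x Lx; rewrite /lineality/M'/= projN proj_id//; exact: Lc.
- by rewrite /lineality/M'/= projN proje oppr0.
- by move=> /Lc; exact/eqP.
Qed.

(** C + Ra is the positive cone of the quotient by the ideal generated by a, and
    suprema pass to quotients by ideals. *)
Lemma lattice_adjoin C a : convex_cone C -> lattice_cone C -> C a ->
  lattice_cone (adjoin C a).
Proof.
move=> [C0 CD CZ] Clat Ca x; have [v [Cv Cvx vmin]] := Clat x.
exists v; split; [exact: sub_adjoin|exact: sub_adjoin|].
move=> u [r r0 Cr] [s s0 Cs]; exists (r + s); first exact: addr_ge0.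
rewrite addrAC; apply: vmin.
  by rewrite scalerDl addrA; apply: CD => //; exact: CZ.
rewrite addrAC scalerDl [r *: a + _]addrC addrA.
by apply: CD => //; exact: CZ.
Qed.

(** If x is not comparable to 0, its positive and negative parts a and b are
    nonzero and disjoint.  If y + r a >= 0 and y + s b >= 0, then -y / n lies
    below both a and b for n large, hence below 0: so C is the intersection of
    C + Ra and C + Rb. *)
Lemma lattice_lexcone C : convex_cone C -> lattice_cone C -> lexcone C.
Proof.
move: C; apply: lineality_ind => C Ccone Clat IH; have [C0 CD CZ] := Ccone.
have [Ctot|] := pselect (total_cone C); first exact: total_lexcone.
move=> /existsNP[x /not_orP[nCx nCNx]].
have [a [Ca Cb amin]] := Clat x; pose b := a - x.
have nCNa : ~ C (- a).
  by move=> CNa; apply: nCNx; have := CD _ _ CNa Cb; rewrite addrA addNr add0r.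
have nCNb : ~ C (- b).
  move=> CNb; apply: nCx; have := CD _ _ Ca CNb.
  by rewrite /b opprB addrC subrK.
have disj z : C (a - z) -> C (b - z) -> C (- z).
  move=> Caz Cbz; have := amin (a - z) Caz; rewrite -/b.
  by rewrite addrAC -/b => /(_ Cbz); rewrite addrAC subrr add0r.
have -> : C = adjoin C a `&` adjoin C b.
  apply/seteqP; split=> [y Cy|y [[r r0 Cr] [s s0 Cs]]].
    by split; exact: sub_adjoin.
  pose n := r + s + 1; have n0 : 0 < n by rewrite /n; lra.
  have : C (- (n^-1 *: - y)).
    have nV : 0 <= n^-1 by rewrite invr_ge0 ltW.
    have step q p : 0 <= q -> q <= n -> C p -> C (y + q *: p) ->
        C (p - n^-1 *: - y).
      move=> q0 qn Cp Cq; have nq : 0 <= n - q by rewrite subr_ge0.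
      have := CZ _ _ nV (CD _ _ Cq (CZ _ _ nq Cp)).
      rewrite -addrA -scalerDl [q + _]addrC subrK scalerDr scalerA.
      by rewrite mulVf ?lt0r_neq0// scale1r scalerN opprK addrC.
    by apply: disj; [apply: (step r)|apply: (step s)] => //; rewrite /n; lra.
  rewrite scalerN opprK => /(CZ n _ (ltW n0)).
  by rewrite scalerA mulfV ?lt0r_neq0// scale1r.
have adj p : C p -> ~ C (- p) -> lexcone (adjoin C p).
  move=> Cp nCNp; apply: (IH _ p).
  - exact: adjoin_cone.
  - exact: lattice_adjoin.
  - by move=> z [Cz CNz]; split; exact: sub_adjoin.
  - by split; [exact: sub_adjoin|exact: adjoin_opp].
  - by case.
by apply: lexconeI; exact: adj.
Qed.

Lemma kernel_lexcone n (B : 'M[R]_(d, n)) : lexcone [set x | x *m B = 0].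
Proof.
have -> : [set x | x *m B = 0] =
          [set x | forall j, j \in enum 'I_n -> lform (col j B) x = 0].
  apply/seteqP; split=> [x /= xB j _|x /= h].
    by rewrite /lform colE mulmxA xB mul0mx mxE.
  apply/matrixP => i j; rewrite ord1 [RHS]mxE -(h j) ?mem_enum//.
  by rewrite lformE [LHS]mxE; apply: eq_bigr => k _; rewrite mxE.
elim: (enum _) => [|j s IH].
  rewrite (_ : mkset _ = setT); first exact: lexconeT.
  by apply/seteqP; split.
rewrite (_ : mkset _ =
  [set x | 0 < lform (col j B) x \/ lform (col j B) x = 0 /\ setT x] `&`
  [set x | 0 < lform (- col j B) x \/ lform (- col j B) x = 0 /\ setT x] `&`
  [set x | forall k, k \in s -> lform (col k B) x = 0]); last first.
  apply/seteqP; split=> x /=.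
    move=> h; split; last by move=> k ks; apply: h; rewrite in_cons ks orbT.
    have jx := h j (mem_head _ _).
    by split; right; split=> //; rewrite lformNl jx oppr0.
  move=> [[h1 h2] h3] k; rewrite in_cons => /orP[/eqP->|]; last exact: h3.
  move: h1 h2; rewrite lformNl.
  by move=> [?|[? _]] [?|[? _]]; lra.
by apply: lexconeI => //; apply: lexconeI; apply: lexcone_lex; exact: lexconeT.
Qed.

Lemma lineality_lexcone C : convex_cone C -> lexcone (lineality C).
Proof.
move=> /lineality_mx[A AP].
rewrite (_ : lineality C = [set x | x *m cokermx A = 0]).
  exact: kernel_lexcone.
apply/seteqP; split=> x /= => [/AP|xA]; first by rewrite submxE => /eqP.
by apply/AP; rewrite submxE; apply/eqP.
Qed.

End Cones.

(** * Values of conditional expectations in lexicographic cones *)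

Section Expectations.
Context (disp : measure_display) (Omega : measurableType disp) (R : realType).
Context (d : nat).
Implicit Types (G : set (set Omega)) (P Q : probability Omega R).
Implicit Types (X Y Z : Omega -> 'rV[R]_d) (c : 'cV[R]_d) (C : set 'rV[R]_d).

Lemma sigma_algebraI G A B : sigma_algebra setT G -> G A -> G B -> G (A `&` B).
Proof.
by move=> hG; rewrite -(measurable_g_measurableTypeE hG); exact: measurableI.
Qed.

Lemma vmeasurable_lform G c X : sigma_algebra setT G -> vmeasurable G X ->
  forall B, measurable B -> G [set w | B (lform c (X w))].
Proof.
move=> hG mX B mB.
have GE := measurable_g_measurableTypeE hG.
have mf : measurable_fun setT
    (fun w : g_sigma_algebraType G => \sum_i (X w 0 i * c i 0)).
  apply: measurable_sum => i; apply: measurable_funM => //.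
  by move=> _ D mD; rewrite setTI GE; exact: mX.
have := mf measurableT B mB; rewrite setTI GE.
by congr G; apply/seteqP; split=> w /=; rewrite lformE.
Qed.

Lemma lexcone_measurable G C X : sigma_algebra setT G -> vmeasurable G X ->
  lexcone C -> G [set w | C (X w)].
Proof.
move=> hG mX; have GE := measurable_g_measurableTypeE hG.
elim=> [|C1 C2 _ GC1 _ GC2|c C' _ GC'].
- by rewrite -GE; exact: measurableT.
- exact: (sigma_algebraI hG GC1 GC2).
- rewrite (_ : mkset _ = [set w | [set` `]0, +oo[] (lform c (X w))] `|`
    ([set w | [set 0] (lform c (X w))] `&` [set w | C' (X w)])).
    rewrite -GE; apply: measurableU; rewrite ?GE.
      by apply: vmeasurable_lform => //; exact: measurable_itv.
    by apply: sigma_algebraI => //; exact: vmeasurable_lform.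
  by apply/seteqP; split=> w /=; rewrite in_itv/= andbT.
Qed.

Lemma vintegrable_lform (mu : {measure set Omega -> \bar R}) c X :
  vintegrable mu X -> mu.-integrable setT (fun w => (lform c (X w))%:E).
Proof.
move=> iX; under eq_fun do rewrite lformE -sumEFin.
apply: integrable_sum => // i _; under eq_fun do rewrite mulrC EFinM.
by apply: integrableZl => //; exact: iX.
Qed.

Lemma integral_lform (mu : {measure set Omega -> \bar R}) c X B :
  vintegrable mu X -> measurable B ->
  (\int[mu]_(w in B) (lform c (X w))%:E =
   \sum_i (c i 0)%:E * \int[mu]_(w in B) (X w 0 i)%:E)%E.
Proof.
move=> iX mB.
have iB i : mu.-integrable B (fun w => (X w 0 i)%:E).
  exact: integrableS (iX i).
under eq_integral do rewrite lformE -sumEFin.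
rewrite integral_sum//; last first.
  by move=> i; under eq_fun do rewrite mulrC EFinM; exact: integrableZl.
apply: eq_bigr => i _; under eq_integral do rewrite mulrC EFinM.
exact: integralZl.
Qed.

Lemma ae_eq0_integral (mu : {measure set Omega -> \bar R}) (B : set Omega)
    (g : Omega -> R) : measurable B ->
  mu.-integrable B (EFin \o g) -> {ae mu, forall w, B w -> 0 <= g w} ->
  (\int[mu]_(w in B) (g w)%:E <= 0)%E -> {ae mu, forall w, B w -> g w = 0}.
Proof.
move=> mB ig g0 int0; have mg := measurable_int mu ig.
have intabs : (\int[mu]_(w in B) `|(EFin \o g) w| = 0)%E.
  apply/eqP; rewrite eq_le integral_ge0 ?andbT//.
  apply: le_trans int0; rewrite le_eqVlt; apply/orP; left; apply/eqP.
  apply: ae_eq_integral => //; first exact: measurableT_comp.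
  by rewrite /ae_eq; apply: filterS g0 => w gw Bw /=; rewrite ger0_norm// gw.
have /(ae_eq_integral_abs _ mB mg) := intabs.
by apply: filterS => w h Bw; have [] := h Bw.
Qed.

Lemma condexp_lform Q G c X Y B : G `<=` measurable ->
  is_condexp Q G X Y -> G B ->
  (\int[Q]_(w in B) (lform c (Y w))%:E = \int[Q]_(w in B) (lform c (X w))%:E)%E.
Proof.
move=> Gm [iX [_ iY] XY] GB; rewrite !integral_lform//; try exact: Gm.
by apply: eq_bigr => i _; rewrite XY.
Qed.

(** Conditional expectation preserves values in a [lexcone], locally on each
    event B of G.  For the lexicographic refinement of a form c: integrating
    over the part of B where c Y < 0 shows that this part is null; integrating
    over the part B0 where c Y = 0 shows that c X = 0 there, so X is in the
    refining cone on B0 and the induction hypothesis applies to B0.  The freedom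
    in B makes this last appeal possible. *)
Lemma condexp_lexcone Q G X Y C : sigma_algebra setT G -> G `<=` measurable ->
  is_condexp Q G X Y -> lexcone C -> forall B, G B ->
  {ae Q, forall w, B w -> C (X w)} -> {ae Q, forall w, B w -> C (Y w)}.
Proof.
move=> hG Gm XY; have [iX [mY iY] _] := XY.
have sub c Z B : G B -> vintegrable Q Z ->
    Q.-integrable B (EFin \o (fun w => lform c (Z w))).
  move=> GB iZ; apply: (integrableS measurableT) => //; first exact: Gm.
  exact: vintegrable_lform.
elim=> [*|C1 C2 _ IH1 _ IH2|c C' _ IH] => [|B GB XC|B GB XC].
- exact: aeW.
- have := IH1 B GB _; have := IH2 B GB _.
  move=> /(_ (filterS _ XC))-/(_ (fun w h Bw => (h Bw).2)) Y2.
  move=> /(_ (filterS _ XC))-/(_ (fun w h Bw => (h Bw).1)) Y1.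
  by apply: filterS2 Y1 Y2 => w h1 h2 Bw; split; [exact: h1|exact: h2].
have fX : {ae Q, forall w, B w -> 0 <= lform c (X w)}.
  by apply: filterS XC => w h /h[/ltW//|[-> _]].
pose Bneg := B `&` [set w | [set` `]-oo, 0[] (lform c (Y w))].
pose B0 := B `&` [set w | [set 0] (lform c (Y w))].
have GBneg : G Bneg.
  by apply: sigma_algebraI => //; apply: vmeasurable_lform.
have GB0 : G B0.
  by apply: sigma_algebraI => //; apply: vmeasurable_lform.
have Yneg : {ae Q, forall w, Bneg w -> lform (- c) (Y w) = 0}.
  apply: ae_eq0_integral; [exact: Gm|exact: sub| |].
    apply: aeW => w [_ /=]; rewrite in_itv/= lformNl oppr_ge0.
    exact: ltW.
  under eq_integral do rewrite lformNl EFinN.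
  have iXB := sub c X Bneg GBneg iX; have iYB := sub c Y Bneg GBneg iY.
  rewrite integralN; last exact: (integrable_add_def (Gm _ GBneg) iYB).
  rewrite oppe_le0 (condexp_lform _ Gm XY)//.
  rewrite (_ : (\int[Q]_(w in Bneg) _)%E =
               (\int[Q]_(w in Bneg) `|(lform c (X w))%:E|)%E) ?integral_ge0//.
  have mX := measurable_int _ iXB.
  apply: ae_eq_integral => //; [exact: Gm|exact: measurableT_comp|].
  by apply: filterS fX => w h [Bw _] /=; rewrite ger0_norm// h.
have X0 : {ae Q, forall w, B0 w -> lform c (X w) = 0}.
  apply: ae_eq0_integral; [exact: Gm|exact: sub| |].
    by apply: filterS fX => w h [Bw _]; exact: h.
  rewrite -(condexp_lform _ Gm XY)// (eq_integral (cst 0%E)) ?integral0//.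
  by move=> w; rewrite inE => -[_ /= ->].
have Y0 : {ae Q, forall w, B0 w -> C' (Y w)}.
  apply: IH => //; apply: filterS2 XC X0 => w h1 h2 Bw.
  by have [|[]//] := h1 Bw.1; rewrite h2// ltxx.
apply: filterS2 Yneg Y0 => w h1 h2 Bw /=.
have [Y0|Y0|Y0] := ltgtP 0 (lform c (Y w)); first by left.
  have /h1 : Bneg w by split=> //=; rewrite in_itv.
  by rewrite lformNl; lra.
by right; split=> //; apply: h2.
Qed.

Lemma ae_const P (p : Prop) : {ae P, forall w, p} -> p.
Proof.
move=> aep; apply: contrapT => np.
have /(negligibleP P measurableT) : P.-negligible setT.
  by apply: negligibleS aep => w _ /=.
move=> PT; have /eqP := etrans (esym (probability_setT P)) PT.
by rewrite onee_eq0.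
Qed.

Lemma null_dominates_ae P Q (p : Omega -> Prop) : Q `<< P ->
  {ae P, forall w, p w} -> {ae Q, forall w, p w}.
Proof.
move=> QP [N [mN PN sN]]; exists N; split=> //.
by move/null_content_dominatesP: QP; exact.
Qed.

Lemma L1_cst P G (x : 'rV[R]_d) : sigma_algebra setT G -> L1 P G (cst x).
Proof.
move=> hG; split=> i.
  move=> B _; rewrite preimage_cst -(measurable_g_measurableTypeE hG).
  by case: ifP.
exact: finite_measure_integrable_cst.
Qed.

Lemma L1B P G X Y : sigma_algebra setT G -> L1 P G X -> L1 P G Y ->
  L1 P G (X \- Y).
Proof.
move=> hG [mX iX] [mY iY]; split=> i.
  have GE := measurable_g_measurableTypeE hG.
  have mZ Z : vmeasurable G Z ->
      measurable_fun setT (fun w : g_sigma_algebraType G => Z w 0 i).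
    by move=> mZ _ D mD; rewrite setTI GE; exact: mZ.
  move=> B mB; have mf := measurable_funB (mZ _ mX) (mZ _ mY).
  have := mf measurableT B mB.
  rewrite setTI GE; congr G.
  by apply/seteqP; split=> w /=; rewrite !mxE.
rewrite (_ : (fun _ => _) =
    (fun w => (X w 0 i)%:E) \- (fun w => (Y w 0 i)%:E))%E; last first.
  by apply/funext => w; rewrite !mxE EFinB.
exact: integrableB.
Qed.

Lemma L1_restrict P G X A : sigma_algebra setT G -> G `<=` measurable -> G A ->
  L1 P G X -> L1 P G (fun w => \1_A w *: X w).
Proof.
move=> hG Gm GA [mX iX]; split=> i.
  have GE := measurable_g_measurableTypeE hG.
  have m1 : measurable_fun setT (\1_A : g_sigma_algebraType G -> R).
    by apply: measurable_indic; rewrite GE.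
  have mXi : measurable_fun setT (fun w : g_sigma_algebraType G => X w 0 i).
    by move=> _ D mD; rewrite setTI GE; exact: mX.
  have mf := measurable_funM m1 mXi.
  move=> B mB; have := mf measurableT B mB.
  by rewrite setTI GE; congr G; apply/seteqP; split=> w /=; rewrite mxE.
have mA := Gm _ GA.
have m1 : measurable_fun setT (\1_A : Omega -> R) by exact: measurable_indic.
apply: le_integrable (iX i) => //.
  under eq_fun do rewrite mxE.
  apply/measurable_EFinP/measurable_funM => //.
  by apply/measurable_EFinP; exact: measurable_int (iX i).
by move=> w _ /=; rewrite lee_fin mxE normrM ger0_norm// ler_piMl.
Qed.

(** * Conditional expectations *)

Lemma condexpP P Q G X : condexp_well_defined P Q G X ->
  is_condexp Q G X (condexp Q G X).
Proof. by move=> [ex _ _]; exact: (xgetPex (cst 0) ex). Qed.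

Lemma is_condexpB Q G X1 X2 Y1 Y2 : sigma_algebra setT G -> G `<=` measurable ->
  is_condexp Q G X1 Y1 -> is_condexp Q G X2 Y2 ->
  is_condexp Q G (X1 \- X2) (Y1 \- Y2).
Proof.
move=> hG Gm [iX1 LY1 E1] [iX2 LY2 E2].
have subE Z1 Z2 B i : vintegrable Q Z1 -> vintegrable Q Z2 -> measurable B ->
    (\int[Q]_(w in B) ((Z1 \- Z2) w 0 i)%:E =
     \int[Q]_(w in B) (Z1 w 0 i)%:E - \int[Q]_(w in B) (Z2 w 0 i)%:E)%E.
  move=> iZ1 iZ2 mB; under eq_integral do rewrite !mxE EFinB.
  by apply: integralB => //; apply: (integrableS measurableT).
split.
- move=> i; rewrite (_ : (fun _ => _) =
      (fun w => (X1 w 0 i)%:E) \- (fun w => (X2 w 0 i)%:E))%E; last first.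
    by apply/funext => w; rewrite !mxE EFinB.
  exact: integrableB.
- exact: L1B.
- move=> B GB i; have mB := Gm _ GB; have [[_ iY1] [_ iY2]] := (LY1, LY2).
  by rewrite !subE// E1// E2.
Qed.

Lemma is_condexp_tower Q G G' X Y Z : G `<=` G' ->
  is_condexp Q G' X Z -> is_condexp Q G Z Y -> is_condexp Q G X Y.
Proof.
move=> GG' [iX _ XZ] [_ LY ZY]; split=> // B GB i.
by rewrite ZY// XZ//; exact: GG'.
Qed.

Lemma is_condexp_ae Q G X Y Y' : G `<=` measurable ->
  is_condexp Q G X Y -> L1 Q G Y' -> {ae Q, forall w, Y w = Y' w} ->
  is_condexp Q G X Y'.
Proof.
move=> Gm [iX [_ iY] XY] LY' YY'; split=> // B GB i; rewrite -XY//.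
have [_ iY'] := LY'; have mB := Gm _ GB.
have mi Z : vintegrable Q Z -> measurable_fun B (fun w => (Z w 0 i)%:E).
  by move=> iZ; exact: measurable_funS (measurable_int _ (iZ i)).
apply: ae_eq_integral => //; [exact: mi|exact: mi|].
by apply: filterS YY' => w -> _.
Qed.

(** [condexp_lexcone] gives the conclusion only Q-almost surely, and P need not
    be dominated by Q.  But the set N where Y is outside C is in G, as a
    [lexcone] is Borel, so Y set to 0 on N is another version under Q.  By
    well-definedness the two versions agree P-almost surely, whereas on N they
    differ because 0 is in C. *)
Lemma condexp_well_defined_lexcone P Q G X Y C :
  sigma_algebra setT G -> G `<=` measurable -> Q `<< P ->
  condexp_well_defined P Q G X -> is_condexp Q G X Y -> lexcone C ->
  {ae P, forall w, C (X w)} -> {ae P, forall w, C (Y w)}.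
Proof.
move=> hG Gm QP [_ _ uniqY] XY lexC XC.
have [_ LY _] := XY; have [mY iY] := LY.
have GT : G setT by rewrite -(measurable_g_measurableTypeE hG).
have YC : {ae Q, forall w, C (Y w)}.
  have : {ae Q, forall w, setT w -> C (Y w)}.
    apply: (condexp_lexcone hG Gm XY lexC GT).
    by apply: filterS (null_dominates_ae QP XC) => w h _.
  by apply: filterS => w; apply.
pose A := [set w | C (Y w)].
have GA : G A by exact: (lexcone_measurable hG mY lexC).
have XY' : is_condexp Q G X (fun w => \1_A w *: Y w).
  apply: (is_condexp_ae Gm XY); first exact: L1_restrict.
  by apply: filterS YC => w Cw; rewrite indicE mem_set// scale1r.
apply: filterS (uniqY _ _ XY XY') => w Yw; apply: contrapT => nCw.
apply: (nCw); rewrite Yw indicE memNset// scale0r; exact: lexcone0.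
Qed.

(** * Means and suprema *)

Lemma sigma_algebra_trivial : sigma_algebra setT [set set0; [set: Omega]].
Proof.
split; first by left.
- by move=> A [->|->]; [right; rewrite setD0|left; rewrite setDv].
- move=> A AG; have [[n An]|nA] := pselect (exists n, A n = setT).
    by right; apply/seteqP; split=> // w _; exists n => //; rewrite An.
  left; apply/seteqP; split=> // w [n _ Aw].
  by case: (AG n) => An; [rewrite An in Aw|apply: nA; exists n].
Qed.

Definition mean P X : 'rV[R]_d := \row_i fine (\int[P]_w (X w 0 i)%:E)%E.

Lemma mean_cst P x : mean P (cst x) = x.
Proof.
apply/rowP => i; rewrite mxE; under eq_integral do rewrite /cst.
by rewrite integral_cst//= probability_setT mule1.
Qed.

Lemma meanB P X Y : vintegrable P X -> vintegrable P Y ->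
  mean P (X \- Y) = mean P X - mean P Y.
Proof.
move=> iX iY; apply/rowP => i; rewrite !mxE.
under eq_integral do rewrite !mxE EFinB.
rewrite (integralB measurableT (iX i) (iY i)) fineB//.
  exact: integrable_fin_num.
exact: integrable_fin_num.
Qed.

(** A mean outside C would be outside a total cone containing C.  Total cones
    are Borel even when C is not, and [condexp_lexcone] applies to them, with
    the trivial sigma-algebra. *)
Lemma mean_cone P X C : convex_cone C -> vintegrable P X ->
  {ae P, forall w, C (X w)} -> C (mean P X).
Proof.
move=> Ccone iX XC; set m := mean P X; apply: contrapT => nCm.
have [M [Mcone Mtot CM nMm]] := total_extension Ccone nCm.
have Gm : [set set0; [set: Omega]] `<=` measurable by move=> _ [] ->.
have Xm : is_condexp P [set set0; setT] X (cst m).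
  split=> //; first by apply: L1_cst; exact: sigma_algebra_trivial.
  move=> _ [] -> i; first by rewrite !integral_set0.
  under eq_integral do rewrite /cst.
  rewrite integral_cst//= probability_setT mule1 mxE fineK//.
  exact: integrable_fin_num (iX i).
apply: nMm; apply: (@ae_const P (M m)).
have XM : {ae P, forall w, setT w -> M (X w)}.
  by apply: filterS XC => w /CM.
have lexM := total_lexcone Mcone Mtot.
have GT : [set set0; [set: Omega]] setT by right.
have := condexp_lexcone sigma_algebra_trivial Gm Xm lexM GT XM.
by apply: filterS => w; apply.
Qed.

(** A supremum V of the constants x and 0 in L^1 may be random, and the upper
    bounds u of x and 0 in the space are uncountably many, so that one cannot
    simply evaluate V at a point.  Averaging does: all the conditions
    0 <= V, x <= V and V <= u pass to the mean of V. *)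
Lemma vsup_lattice P G C (I : Type) (Theta : set I) (i j : I) :
  sigma_algebra setT G -> convex_cone C -> Theta i -> Theta j -> i <> j ->
  (forall X : I -> Omega -> 'rV[R]_d,
     (forall theta, Theta theta -> L1 P G (X theta)) ->
     exists V, is_vsup P G C Theta X V) ->
  lattice_cone C.
Proof.
move=> hG Ccone Ti Tj ij hsup x.
pose X k : Omega -> 'rV[R]_d := if pselect (k = i) then cst x else cst 0.
have Xi : X i = cst x by rewrite /X; case: pselect.
have Xj : X j = cst 0 by rewrite /X; case: pselect => // ji; case: ij.
have LX k : L1 P G (X k) by rewrite /X; case: pselect => ki; exact: L1_cst.
have [//|V [LV Vub Vmin]] := hsup X.
have [_ iV] := LV.
have cstL (y : 'rV[R]_d) : L1 P G (cst y) by exact: L1_cst.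
have key Y Z : L1 P G Y -> L1 P G Z -> vle P G C Y Z -> C (mean P Z - mean P Y).
  move=> [_ iY] [_ iZ] [[_ iZY] CZY].
  by rewrite -meanB//; exact: mean_cone.
exists (mean P V); split.
- have := Vub _ Tj; rewrite Xj => /(key _ _ (cstL _) LV).
  by rewrite mean_cst subr0.
- have := Vub _ Ti; rewrite Xi => /(key _ _ (cstL _) LV).
  by rewrite mean_cst.
- move=> u Cu Cux; rewrite -(mean_cst P u); apply: key => //.
  apply: Vmin => // k _; split; first by apply: L1B; first exact: hG.
  by apply: aeW => w; rewrite /X /=; case: pselect => ki; rewrite /= ?subr0.
Qed.

Lemma ordering_cone_convex (le : 'rV[R]_d -> 'rV[R]_d -> Prop) :
  is_vector_preorder le -> convex_cone (ordering_cone le).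
Proof.
move=> hle; split.
- exact: (vpre_refl hle).
- move=> x y x0 y0; apply: (vpre_trans hle y0).
  by rewrite -[X in le X _]add0r; exact: (vpre_add hle).
- by move=> r x r0 x0; have := vpre_scale hle r0 x0; rewrite scaler0.
Qed.

Lemma vle_refl P G C X : sigma_algebra setT G -> convex_cone C ->
  L1 P G X -> vle P G C X X.
Proof.
move=> hG [C0 _ _] LX; split; first exact: L1B.
by apply: aeW => w /=; rewrite subrr.
Qed.

Lemma vle_trans P G C X Y Z : sigma_algebra setT G -> convex_cone C ->
  L1 P G X -> L1 P G Z ->
  vle P G C X Y -> vle P G C Y Z -> vle P G C X Z.
Proof.
move=> hG [_ CD _] LX LZ [_ XY] [_ YZ]; split; first exact: L1B.
apply: filterS2 XY YZ => w /= h1 h2.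
by rewrite -(subrK (Y w) (Z w)) -addrA; exact: CD.
Qed.

(** Monotonicity of the conditional expectation combined with the tower
    property.  D is a cone for which the former is known, possibly smaller than
    the ordering cone C. *)
Lemma condexp_tower_vle P Q G G' C D X Y :
  sigma_algebra setT G -> sigma_algebra setT G' ->
  G `<=` measurable -> G `<=` G' -> Q `<< P ->
  (forall Z, L1 P G' Z -> condexp_well_defined P Q G Z) ->
  condexp_well_defined P Q G' X -> condexp_well_defined P Q G X ->
  L1 P G' Y -> lexcone D -> D `<=` C ->
  {ae P, forall w, D ((Y \- condexp Q G' X) w)} ->
  vle P G C (condexp Q G X) (condexp Q G Y).
Proof.
move=> hG hG' Gm GG' QP wd wdX' wdX LY lexD DC YD.
have EX' := condexpP wdX'; have LX' : L1 P G' (condexp Q G' X).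
  by case: wdX' => _ + _; exact.
have wdE := wd _ LX'; have wdY := wd _ LY.
have tower := is_condexp_tower GG' EX' (condexpP wdE).
have [_ LEX uniqX] := wdX; have [_ LEY _] := wdY.
split.
  apply: L1B => //; first exact: LEY (condexpP wdY).
  exact: LEX (condexpP wdX).
have EB := is_condexpB hG Gm (condexpP wdY) (condexpP wdE).
have wdB := wd _ (L1B hG' LY LX').
have := condexp_well_defined_lexcone hG Gm QP wdB EB lexD YD.
apply: filterS2 (uniqX _ _ (condexpP wdX) tower) => w /= -> ?; exact: DC.
Qed.

(** The difference between a supremum and a member of its family has values in a
    [lexcone] inside C: in C itself when there are two indices, by
    [vsup_lattice], and in the lineality space of C when there is one, because
    then the member is an upper bound of its family. *)
Lemma vsup_slack_lexcone P C (I : Type) (Theta : set I) (G0 : set (set Omega)) :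
  sigma_algebra setT G0 -> convex_cone C ->
  (forall X : I -> Omega -> 'rV[R]_d,
     (forall theta, Theta theta -> L1 P G0 (X theta)) ->
     exists V, is_vsup P G0 C Theta X V) ->
  exists D, [/\ lexcone D, D `<=` C &
    forall G (X : I -> Omega -> 'rV[R]_d) V,
      sigma_algebra setT G ->
      (forall theta, Theta theta -> L1 P G (X theta)) ->
      is_vsup P G C Theta X V ->
      forall theta, Theta theta -> {ae P, forall w, D ((V \- X theta) w)}].
Proof.
move=> hG0 Ccone hsup.
have [[[i j] /= [Ti Tj ij]]|single] :=
    pselect (exists p, [/\ Theta p.1, Theta p.2 & p.1 <> p.2]).
  exists C; split=> //.
    apply: lattice_lexcone => //.
    exact: (vsup_lattice hG0 Ccone Ti Tj ij hsup).
  by move=> G X V hG LX [_ Vub _] theta /Vub[].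
exists (lineality C); split; first exact: lineality_lexcone.
  by move=> x [].
move=> G X V hG LX [LV Vub Vmin] theta Ttheta.
have [_ VC] := Vub _ Ttheta.
have [|_ CV] := Vmin (X theta) (LX _ Ttheta).
  move=> k Tk; rewrite (_ : k = theta); last first.
    by apply: contrapT => kt; apply: single; exists (k, theta).
  exact: vle_refl (LX _ Ttheta).
by apply: filterS2 VC CV => w /= h1 h2; split=> //; rewrite opprB.
Qed.
End Expectations.

(** * The recursion *)

Theorem theorem3p2 (R : realType) (disp : measure_display)
    (Omega : measurableType disp) (P : probability Omega R)
    (T : nat) (Fil : nat -> set (set Omega)) (hFil : is_filtration T Fil)
    (d : nat)
    (Theta : set 'rV[R]_d) (Theta_neq0 : Theta !=set0)
    (Theta_fin : finite_set Theta)
    (Q : 'rV[R]_d -> probability Omega R)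
    (hQ : forall theta, Theta theta -> Q theta `<< P)
    (hE : forall theta t s (X : Omega -> 'rV[R]_d), Theta theta ->
       (t <= s)%N -> (s <= T)%N -> L1 P (Fil s) X ->
       condexp_well_defined P (Q theta) (Fil t) X)
    (le : 'rV[R]_d -> 'rV[R]_d -> Prop) (hle : is_vector_preorder le)
    (hsup : forall t (X : 'rV[R]_d -> Omega -> 'rV[R]_d), (t <= T)%N ->
       (forall theta, Theta theta -> L1 P (Fil t) (X theta)) ->
       exists V, is_vsup P (Fil t) (ordering_cone le) Theta X V)
    (vsup : nat -> ('rV[R]_d -> Omega -> 'rV[R]_d) -> Omega -> 'rV[R]_d)
    (hvsup : forall t (X : 'rV[R]_d -> Omega -> 'rV[R]_d), (t <= T)%N ->
       (forall theta, Theta theta -> L1 P (Fil t) (X theta)) ->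
       (exists V, is_vsup P (Fil t) (ordering_cone le) Theta X V) ->
       is_vsup P (Fil t) (ordering_cone le) Theta X (vsup t X))
    (m k : nat) (U : ptopologicalType)
    (SS : set 'rV[R]_m) (A : set U)
    (F : nat -> 'rV[R]_m -> U -> 'rV[R]_k -> 'rV[R]_m)
    (Z : nat -> Omega -> 'rV[R]_k) (s0 : 'rV[R]_m)
    (adm : nat -> (Omega -> 'rV[R]_m) -> set (Omega -> U))
    (states : nat -> set (Omega -> 'rV[R]_m))
    (hS : is_control_system T Fil SS A F Z s0 adm states)
    (ell : 'rV[R]_m -> 'rV[R]_d)
    (hell : forall t S phis, (t <= T)%N -> states t S ->
       admissible T F Z adm t S phis ->
       L1 P (Fil T) (ell \o terminal_state F Z t S phis)) :
  let E := fun theta t => @condexp disp Omega R (Q theta) (Fil t) d in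
  let V := value_set T F Z adm ell E vsup in
  forall t S, (t < T)%N -> states t S ->
    set_le_lower P (Fil t) (ordering_cone le)
      (V t S) (recursion_set F Z adm E vsup t S (V t.+1)) /\
    set_le_upper P (Fil t) (ordering_cone le)
      (V t S) (recursion_set F Z adm E vsup t S (V t.+1)).
Proof.
move=> E V t S tT St; have tleT := ltnW tT.
have Ccone := ordering_cone_convex hle.
set C := ordering_cone le in Ccone *.
have [sFil mFil iFil] := hFil.
have hG s : (s <= T)%N -> sigma_algebra setT (Fil s) by exact: sFil.
have [D [lexD DC slack]] :=
  vsup_slack_lexcone (hG _ (leq0n T)) Ccone (fun X => @hsup 0%N X (leq0n T)).
have LE theta s u X : Theta theta -> (s <= u)%N -> (u <= T)%N ->
    L1 P (Fil u) X -> L1 P (Fil s) (E theta s X).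
  move=> Th su uT LX; have wd := hE _ _ _ _ Th su uT LX; have [_ L _] := wd.
  exact: L (condexpP wd).
pose Ef s (X : Omega -> 'rV[R]_d) theta := E theta s X.
have vsupP s u X : (s <= u)%N -> (u <= T)%N -> L1 P (Fil u) X ->
    is_vsup P (Fil s) C Theta (Ef s X) (vsup s (Ef s X)).
  move=> su uT LX; have sT := leq_trans su uT.
  have LEX theta : Theta theta -> L1 P (Fil s) (E theta s X).
    by move=> Th; exact: LE LX.
  by apply: hvsup => //; exact: hsup.
pose loss u S' phis := ell \o terminal_state F Z u S' phis.
(* The comparison of v-sup of E_t[L] with v-sup of E_t[X], where L is the loss
   of phi :: phis and X the element of the next value set given by phis.  At
   t+1 = T that element is L itself, not a supremum. *)
have key phi phis X : admissible T F Z adm t S (phi :: phis) ->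
    X = (if t.+1 == T then ell \o next_state F Z t S phi
         else vsup t.+1 (Ef t.+1 (loss t.+1 (next_state F Z t S phi) phis))) ->
    L1 P (Fil t.+1) X /\
    vle P (Fil t) C (vsup t (Ef t (loss t S (phi :: phis)))) (vsup t (Ef t X)).
  move=> adm_phis; have [_ adm_phi adm'] := adm_phis.
  have St' := cs_next hS tT St adm_phi.
  set S' := next_state F Z t S phi in adm' St' *.
  have LL : L1 P (Fil T) (loss t S (phi :: phis)) by exact: hell.
  rewrite -[loss t S _]/(loss t.+1 S' phis) in LL *.
  have [tT1|tT1] := eqVneq t.+1 T => ->.
    have phis0 : phis = [::].
      by case: phis adm' {adm_phis LL} => // ? ? [] /=; rewrite tT1 ltnn.
    move: LL; rewrite phis0 /loss /= -{1}tT1 => LL; split=> //.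
    apply: vle_refl => //; first exact: hG.
    by have [] := vsupP t t.+1 _ (leqnSn t) tT LL.
  set L := loss _ _ _ in LL *.
  have supX := vsupP t.+1 T L tT (leqnn T) LL.
  set X' := vsup t.+1 _ in supX *.
  have LX : L1 P (Fil t.+1) X' by case: supX.
  split=> //.
  have [_ Xub _] := vsupP t t.+1 X' (leqnSn t) tT LX.
  have [LVL _] := vsupP t T L tleT (leqnn T) LL; apply.
    by have [] := vsupP t t.+1 X' (leqnSn t) tT LX.
  move=> theta Th; apply: (@vle_trans _ _ _ _ P _ C _ (E theta t X')) => //.
  - exact: hG.
  - exact: LE LL.
  - by have [] := vsupP t t.+1 X' (leqnSn t) tT LX.
  - apply: (@condexp_tower_vle _ _ _ _ P (Q theta) _ (Fil t.+1) C D) => //.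
    + exact: hG.
    + exact: hG.
    + exact: mFil.
    + exact: iFil.
    + exact: hQ.
    + by move=> W LW; exact: hE LW.
    + exact: hE LL.
    + exact: hE LL.
    + apply: (slack _ (Ef t.+1 L) _ (hG _ tT) _ supX) => //.
      by move=> theta' Th'; apply: (LE _ _ _ _ Th' tT (leqnn T) LL).
  - exact: Xub.
have sumE (X Y : Omega -> 'rV[R]_d) : X \+ (Y \- X) = Y.
  by apply/funext => w /=; rewrite addrC subrK.
have subE (X Y : Omega -> 'rV[R]_d) : Y \- (Y \- X) = X.
  by apply/funext => w /=; rewrite opprB addrC subrK.
have tNT : (t == T) = false by rewrite ltn_eqF.
split.
- move=> Y [phi [X [adm_phi VX ->]]].
  have [phis adm_phis XE] : exists2 phis,
      admissible T F Z adm t.+1 (next_state F Z t S phi) phis &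
      X = (if t.+1 == T then ell \o next_state F Z t S phi
         else vsup t.+1 (Ef t.+1 (loss t.+1 (next_state F Z t S phi) phis))).
    move: VX; rewrite /V /value_set; case: eqP => [tT1 ->|_ [phis ? <-]].
      by exists [::].
    by exists phis.
  have adm_phis' : admissible T F Z adm t S (phi :: phis) by [].
  have [_ le_XY] := key _ _ _ adm_phis' XE.
  exists (vsup t (Ef t (loss t S (phi :: phis)))).
    by rewrite /V /value_set tNT; exists (phi :: phis).
  exists (vsup t (Ef t X) \- vsup t (Ef t (loss t S (phi :: phis)))).
    exact: le_XY.
  exact: sumE.
- move=> Y; rewrite {1}/V /value_set tNT => -[[|phi phis] adm_phis <-].
    by move: tT; rewrite adm_phis ltnn.
  have [_ adm_phi adm'] := adm_phis.
  pose X := if t.+1 == T then ell \o next_state F Z t S phi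
         else vsup t.+1 (Ef t.+1 (loss t.+1 (next_state F Z t S phi) phis)).
  have [_ le_XY] := key _ _ X adm_phis erefl.
  exists (vsup t (Ef t X)).
    exists phi, X; split=> //; rewrite /X /V /value_set.
    by case: eqP => // _; exists phis.
  exists (vsup t (Ef t X) \- vsup t (Ef t (loss t S (phi :: phis)))).
    exact: le_XY.
  exact: subE.
Qed.
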